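(* Let $r,n\ge1$ be integers and $c,d\in\mathbb{Z}$, and put $\mathscr{d}_1=\gcd(c-d,n)$, $\mathscr{d}_2=\gcd(c+(r-1)d,n)$. Let $B_{c,d}$ be the $r\times r$ matrix with diagonal entries $c$ and off-diagonal entries $d$; let $S_{cochar}$ be the number of $\boldsymbol{x}\in(\mathbb{Z}/n\mathbb{Z})^r$ with $B_{c,d}\boldsymbol{x}\equiv\boldsymbol{0}\pmod n$, and let $S_{coroot}$ be the number of $\boldsymbol{x}=(x_1,\dots,x_r)\in(\mathbb{Z}/n\mathbb{Z})^r$ with $(c-d)(x_i-x_r)\equiv0\pmod n$ for all $1\le i\le r-1$ and $(c+(r-1)d)(x_1+\cdots+x_r)\equiv 0\pmod n$. Then \[S_{cochar}=S_{coroot}\cdot\frac{1}{n}\cdot\mathrm{lcm}\left(\gcd\left(\mathscr{d}_2,\frac{dn}{\mathscr{d}_1}\right),\frac{n}{\gcd(n,r)}\right).\] *)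

(* Defs.v *)
From mathcomp Require Import all_boot all_order all_algebra.

Set Implicit Arguments.
Unset Strict Implicit.
Unset Printing Implicit Defensive.

Import GRing.Theory Num.Theory.
Local Open Scope ring_scope.

(* A vector of (Z/nZ)^r is given by its residues in {0, ..., n-1}, i.e. by an
   element of 'cV['I_n]_r; unlike 'Z_n, this is also right for n = 1.  All the
   conditions imposed below on such vectors are integer congruences modulo n,
   hence do not depend on the choice of representatives. *)
Definition lift_int (n r : nat) (x : 'cV['I_n]_r) : 'cV[int]_r :=
  map_mx (fun a : 'I_n => (nat_of_ord a)%:Z) x.

Definition Bmx (r : nat) (c d : int) : 'M[int]_r :=
  \matrix_(i, j) (if i == j then c else d).

Definition last_ord (r : nat) (r_gt0 : (0 < r)%N) : 'I_r :=
  Ordinal (etrans (ltn_predL r) r_gt0).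

Definition S_cochar (r n : nat) (c d : int) : nat :=
  #|[set x : 'cV['I_n]_r |
      [forall i : 'I_r,
         ((Bmx r c d *m lift_int x) i ord0 == 0 %[mod n%:Z])%Z]]|.

(* With indices starting at 0, the rows 1 <= i <= r - 1 of the first family
   of congruences are those with i < r.-1, and x_r is the last entry. *)
Definition S_coroot (r n : nat) (r_gt0 : (0 < r)%N) (c d : int) : nat :=
  #|[set x : 'cV['I_n]_r |
      [forall i : 'I_r, (i < r.-1)%N ==>
         ((c - d) * (lift_int x i ord0 - lift_int x (last_ord r_gt0) ord0)
            == 0 %[mod n%:Z])%Z]
      && ((c + (r%:Z - 1) * d) * (\sum_(i < r) lift_int x i ord0)
            == 0 %[mod n%:Z])%Z]|.

(* Main.v *)
(* Both systems of congruences cut out, inside the subgroup H of vectors of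
   (Z/nZ)^r with (c - d)(x_i - x_r) = 0 for all i, the kernel of a linear form:
   (c - d) x_r + d sum x_i for S_cochar (the last row of B_{c,d}), and
   (c + (r - 1) d) sum x_i for S_coroot.  With e = c + (r - 1) d and
   d1 = gcd (c - d) n, the images of H under these two forms are generated by
   e, d n / d1 and by e r, e n / d1 respectively, so comparing
   #|H| = #|kernel| * #|image| for the two forms gives the ratio of the two
   counts; what remains is an identity between gcds. *)
Require Import Defs.
From mathcomp Require Import all_boot all_order all_algebra.
From mathcomp Require Import ring.

Set Implicit Arguments.
Unset Strict Implicit.
Unset Printing Implicit Defensive.

Import Order.TTheory GRing.Theory Num.Theory.
Local Open Scope ring_scope.

(** * Reduction modulo [n.+1] and integer lifts *)

Definition redmod (n r : nat) (v : 'cV[int]_r) : 'cV['I_n.+1]_r :=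
  map_mx (fun z : int => inord `|(z %% n.+1%:Z)%Z|%N) v.

Lemma lift_redmod (n r : nat) (v : 'cV[int]_r) :
  exists w, lift_int (redmod n v) = v + n.+1%:Z *: w.
Proof.
exists (- map_mx (fun z => (z %/ n.+1%:Z)%Z) v).
apply/matrixP => i j; rewrite !mxE inordK; last first.
  by rewrite -ltz_nat abszE ger0_norm ?modz_ge0 // ltz_pmod.
rewrite abszE ger0_norm ?modz_ge0 //.
rewrite [X in _ = X + _](divz_eq (v i j) n.+1).
by rewrite mulrN [_ * n.+1%:Z]mulrC addrAC subrr add0r.
Qed.

Lemma lift_int_inj_mod (n r : nat) (x y : 'cV['I_n]_r) (w : 'cV[int]_r) :
  lift_int x - lift_int y = n%:Z *: w -> x = y.
Proof.
move=> xy; apply/matrixP => i j; apply/val_inj => /=.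
have /matrixP/(_ i j) := xy; rewrite !mxE => /eqP.
rewrite subr_eq => /eqP /(congr1 (modz^~ n)).
by rewrite mulrC modzMDl !modz_nat !modn_small // => -[].
Qed.

(** * Counting the kernel of a linear form on a subgroup through its image *)

Section KernelImage.

Variables (n r : nat) (H : pred 'cV[int]_r) (w : 'rV[int]_r).
Variables (x1 x2 : 'cV[int]_r) (al be : int).
Let phi (v : 'cV[int]_r) : int := (w *m v) ord0 ord0.
Let g := gcdz (gcdz al be) n.+1.

(** [H] is a subgroup of Z^r containing all multiples of [n.+1], so membership depends on residues
    only; the values [al] and [be] of the form at [x1] and [x2] generate its image modulo [n.+1]. *)
Hypothesis HD : forall u v, H u -> H v -> H (u + v).
Hypothesis HZ : forall k v, H v -> H (k *: v).
Hypothesis Hn : forall v, H (n.+1%:Z *: v).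
Hypotheses (Hx1 : H x1) (Hx2 : H x2).
Hypotheses (phi1 : phi x1 = al) (phi2 : (n.+1 %| phi x2 - be)%Z).
Hypothesis phiH : forall v, H v -> (g %| phi v)%Z.

Let phiD u v : phi (u + v) = phi u + phi v.
Proof. by rewrite /phi mulmxDr mxE. Qed.

Let phiZ k v : phi (k *: v) = k * phi v.
Proof. by rewrite /phi -scalemxAr mxE. Qed.

(** Two Bezout identities give g = s (u al + v be) + t (n + 1), so s (u x1 + v x2) is a preimage. *)
Lemma exists_gcd_preimage : exists2 x0, H x0 & (n.+1 %| phi x0 - g)%Z.
Proof.
have [u [v uv]] := Bezoutz al be.
have [s [t st]] := Bezoutz (gcdz al be) n.+1.
exists (s *: (u *: x1 + v *: x2)); first by do !apply/HZ || apply/HD.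
rewrite !(phiZ, phiD) phi1 /g -st -uv.
rewrite (_ : _ - _ = (s * v) * (phi x2 - be) - t * n.+1); last by ring.
by rewrite rpredB ?dvdz_mull.
Qed.

(* The image of H under phi is gZ/nZ, of size n / g. *)
Lemma card_kernel_image :
  (#|[set x : 'cV['I_n.+1]_r | H (lift_int x)]| * `|g| =
   n.+1 * #|[set x : 'cV['I_n.+1]_r |
       H (lift_int x) && (n.+1 %| phi (lift_int x))%Z]|)%N.
Proof.
have [x0 Hx0 phix0] := exists_gcd_preimage.
have g_gt0 : 0 < g by rewrite lt_neqAle eq_sym gcdz_eq0 andbF.
have /dvdzP [m nE] : (g %| n.+1%:Z)%Z by exact: dvdz_gcdr.
have m_gt0 : 0 < m by rewrite -(pmulr_lgt0 _ g_gt0) -nE.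
case: m m_gt0 nE => // m m_gt0 nE.
set K := [set x | _ && _]; set HH := [set x | _].
(* Here [n.+1] = m g, and the multiples j x0 with j < m represent the cosets of [K] in [HH]; [f] is
   the resulting bijection. *)
pose f (p : 'cV['I_n.+1]_r * 'I_m) :=
  redmod n (lift_int p.1 + (p.2)%:Z *: x0).
have HKf : HH = f @: setX K setT.
  apply/setP => y; apply/idP/imsetP.
    (* If phi y = k g, subtracting (k mod m) x0 leaves a multiple of m g = [n.+1], hence a point of
       the kernel. *)
    rewrite inE => Hy; have /dvdzP [k kE] := phiH Hy.
    have k_ge0 : 0 <= (k %% m)%Z by rewrite modz_ge0 // gt_eqF.
    have k_lt : (`|(k %% m)%Z| < m)%N.
      by rewrite -ltz_nat abszE ger0_norm // ltz_pmod.
    have [s sE] := lift_redmod n (lift_int y - (k %% m)%Z *: x0).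
    exists (redmod n (lift_int y - (k %% m)%Z *: x0), Ordinal k_lt).
      rewrite !inE /= andbT sE; apply/andP; split.
        by rewrite -scaleNr; do !apply: HD => //; apply: HZ.
      rewrite !(phiD, phiZ) -scaleNr phiZ kE [X in X * g](divz_eq k m) nE.
      move: phix0; rewrite nE => /dvdzP [q /eqP]; rewrite subr_eq => /eqP ->.
      apply/dvdzP; exists ((k %/ m)%Z - (k %% m)%Z * q + phi s); ring.
    have [t tE] := lift_redmod n (lift_int (redmod n
      (lift_int y - (k %% m)%Z *: x0)) + `|(k %% m)%Z|%N%:Z *: x0).
    apply/esym/(@lift_int_inj_mod _ _ _ _ (s + t)).
    rewrite {1}/f tE /= sE abszE ger0_norm //.
    by apply/matrixP => a b; rewrite !mxE; ring.
  case=> -[x j]; rewrite !inE /= andbT => /andP [Hx _] ->.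
  rewrite /f /=; have [s ->] := lift_redmod n (lift_int x + (j%:Z) *: x0).
  by do !apply: HD => //; apply: HZ.
have f_inj : {in setX K setT &, injective f}.
  case=> [x j] [y k]; rewrite !inE /= !andbT.
  move=> /andP [_ /dvdzP [a phix]] /andP [_ /dvdzP [b phiy]].
  rewrite /f /= => fE.
  have [s sE] := lift_redmod n (lift_int x + (j%:Z) *: x0).
  have [t tE] := lift_redmod n (lift_int y + (k%:Z) *: x0).
  (* Applying [phi] to [E] gives j g = k g modulo m g, and j and k are both below m. *)
  move: sE; rewrite fE tE => E; have {fE tE}jk : j = k.
    have := congr1 phi E; rewrite !(phiD, phiZ) phix phiy.
    move: phix0 => /dvdzP [q /eqP]; rewrite subr_eq => /eqP ->; rewrite nE => e.
    have {e} : k%:Z = j%:Z + (a - b + phi s - phi t + (j%:Z - k%:Z) * q) * m%:Z.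
      apply: (mulIf (lt0r_neq0 g_gt0)).
      (* [S] is the left side of [e] without its term k g. *)
      set S := b * (m%:Z * g) + k%:Z * (q * (m%:Z * g)) + m%:Z * g * phi t.
      apply: (addIr S); rewrite /S.
      transitivity (b * (m%:Z * g) + k%:Z * (q * (m%:Z * g) + g)
                    + m%:Z * g * phi t); first by ring.
      by rewrite e; ring.
    move/(congr1 (modz^~ m)); rewrite addrC modzMDl !modz_nat !modn_small //.
    by case=> kj; apply/val_inj.
  rewrite jk; congr (_, _); apply: (@lift_int_inj_mod _ _ _ _ (t - s)).
  move: E; rewrite jk scalerBr => E.
  apply/eqP; rewrite subr_eq; apply/eqP/(@addIr _ (k%:Z *: x0)).
  apply: (@addIr _ (n.+1%:Z *: s)); rewrite -E.
  by apply/matrixP => i l; rewrite !mxE; ring.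
rewrite HKf card_in_imset // cardsX cardsT card_ord -mulnA mulnC.
by congr (_ * _)%N; have := congr1 absz nE; rewrite abszM /=.
Qed.

End KernelImage.

(** * The subgroup H of the overview, pulled back to integer vectors *)

Definition equimod (r : nat) (n : int) (r_gt0 : (0 < r)%N) (a : int)
    (v : 'cV[int]_r) :=
  [forall i, (n %| a * (v i ord0 - v (last_ord r_gt0) ord0))%Z].

Lemma equimodD r n (r_gt0 : (0 < r)%N) a u v :
  equimod n r_gt0 a u -> equimod n r_gt0 a v -> equimod n r_gt0 a (u + v).
Proof.
move=> /forallP Hu /forallP Hv; apply/forallP => i; rewrite !mxE.
by rewrite opprD addrACA mulrDr rpredD.
Qed.

Lemma equimodZ r n (r_gt0 : (0 < r)%N) a k v :
  equimod n r_gt0 a v -> equimod n r_gt0 a (k *: v).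
Proof.
move=> /forallP Hv; apply/forallP => i; rewrite !mxE.
by rewrite -mulrBr mulrCA dvdz_mull.
Qed.

Lemma equimod_scale r n (r_gt0 : (0 < r)%N) (a k : int) v :
  (n %| a * k)%Z -> equimod n r_gt0 a (k *: v).
Proof.
move=> nk; apply/forallP => i; rewrite !mxE.
by rewrite -mulrBr mulrA dvdz_mulr.
Qed.

Lemma equimod_const r n (r_gt0 : (0 < r)%N) a k :
  equimod n r_gt0 a (const_mx k).
Proof. by apply/forallP => i; rewrite !mxE subrr mulr0. Qed.

Lemma Bmx_mul r c d (v : 'cV[int]_r) i :
  (Bmx r c d *m v) i ord0 = (c - d) * v i ord0 + d * \sum_j v j ord0.
Proof.
rewrite mxE (bigD1 i) //= [in RHS](bigD1 i) //= !mxE eqxx mulrDr mulr_sumr.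
rewrite mulrBl addrA subrK; congr (_ + _); apply: eq_bigr => j ji.
by rewrite !mxE eq_sym (negPf ji).
Qed.

(** The quotient a / k is a unit modulo m: Bezout writes k = u a + v m k, so y k is a combination of
    a y and m k. *)
Lemma dvdz_mul_gcd (m k a y : int) : k != 0 ->
  gcdz a (m * k) = k -> (m * k %| a * y)%Z -> (m %| y)%Z.
Proof.
move=> k0 gk may; rewrite -(dvdz_mul2r k0).
have [u [v uv]] := Bezoutz a (m * k); rewrite gk in uv.
rewrite -[X in y * X]uv.
rewrite (_ : y * _ = u * (a * y) + y * v * (m * k)); last by ring.
by rewrite rpredD // dvdz_mull.
Qed.

(** All entries agree with the last one modulo m. On H both forms thus depend only on the last entry
    and on [s], which bounds their images. *)
Lemma equimod_sum r (r_gt0 : (0 < r)%N) (m k a : int) v : k != 0 ->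
  gcdz a (m * k) = k -> equimod (m * k) r_gt0 a v ->
  exists s, \sum_i v i ord0 = r%:Z * v (last_ord r_gt0) ord0 + s * m.
Proof.
move=> k0 gk /forallP Hv; set l := v _ _.
have /dvdzP [s sE] : (m %| \sum_i (v i ord0 - l))%Z.
  by apply: rpred_sum => i _; apply: dvdz_mul_gcd k0 gk _.
exists s; rewrite -sE sumrB sumr_const card_ord -mulr_natl natz.
by rewrite addrC subrK.
Qed.

(** * The identity between gcds *)

Lemma dvdz_gcd_mul (p x y z : int) :
  (p %| gcdz x y * z)%Z = (p %| x * z)%Z && (p %| y * z)%Z.
Proof. by rewrite -dvdz_gcd -mulz_gcdl !dvdzE !abszM absz_nat. Qed.

(** Both sides have the same divisors p. For p dividing n, p divides gcd(n, r) z exactly when it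
    divides r z, and r d m = e m modulo n because n divides a m = u n. *)
Lemma gcd_images (e a d u m k n r : int) :
  n = m * k -> a = u * k -> e - a = r * d ->
  gcdz n r * gcdz (gcdz (gcdz e (d * m)) n) (n %/ gcdz n r)%Z =
  gcdz (gcdz (e * r) (e * m)) n.
Proof.
move=> nE aE eE; set G := gcdz n r.
have GB : G * (n %/ G)%Z = n by rewrite mulrC divzK ?dvdz_gcdl.
have rdm : r * (d * m) = e * m - u * n.
  by rewrite mulrA -eE aE nE; ring.
rewrite -[X in X * _]gez0_abs // mulz_gcdr GB.
have dvdE p : (p %| gcdz (G * gcdz (gcdz e (d * m)) n) n)%Z =
              (p %| gcdz (gcdz (e * r) (e * m)) n)%Z.
  rewrite !dvdz_gcd; case: (boolP (p %| n)%Z) => [pn|]; last by rewrite !andbF.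
  rewrite dvdz_gcd_mul dvdz_mulr //= [r * _]mulrC !dvdz_gcd_mul.
  rewrite (dvdz_mulr r pn) !andbT [d * m * r]mulrC rdm.
  by rewrite rpredBr // dvdz_mull.
(* Nonnegative integers with the same divisors divide each other, hence are equal. *)
apply/eqP; rewrite -[X in X == _]gez0_abs // -[X in _ == X]gez0_abs //.
by rewrite eqz_nat eqn_dvd -!dvdzE dvdE -dvdE !dvdzz.
Qed.

(** * The two counts as kernels of forms on H, and the comparison *)

Lemma S_cocharE r n (r_gt0 : (0 < r)%N) c d :
  S_cochar r n.+1 c d = #|[set x : 'cV['I_n.+1]_r |
    equimod n.+1 r_gt0 (c - d) (lift_int x) &&
    (n.+1 %| (row (last_ord r_gt0) (Bmx r c d) *m lift_int x) ord0 ord0)%Z]|.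
Proof.
apply: eq_card => x; rewrite !inE -row_mul mxE Bmx_mul.
set v := lift_int x; set l := last_ord r_gt0; set s := \sum_j _.
(* Each row of the system is the last row plus (c - d)(x_i - x_r). If all rows vanish modulo [n.+1],
   so do these differences, and conversely. *)
have diffE i : (c - d) * v i ord0 + d * s =
    (c - d) * (v i ord0 - v l ord0) + ((c - d) * v l ord0 + d * s) by ring.
apply/forallP/andP => [h | [/forallP h hl] i].
  have h' i : (n.+1 %| (c - d) * v i ord0 + d * s)%Z.
    by have := h i; rewrite eqz_mod_dvd subr0 Bmx_mul.
  split=> //; apply/forallP => i; have := h' i.
  by rewrite diffE rpredDr.
by rewrite eqz_mod_dvd subr0 Bmx_mul diffE rpredD.
Qed.

Lemma S_corootE r n (r_gt0 : (0 < r)%N) c d :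
  S_coroot n.+1 r_gt0 c d = #|[set x : 'cV['I_n.+1]_r |
    equimod n.+1 r_gt0 (c - d) (lift_int x) &&
    (n.+1 %| ((const_mx (c + (r%:Z - 1) * d) : 'rV_r) *m lift_int x)
               ord0 ord0)%Z]|.
Proof.
apply: eq_card => x; rewrite !inE; congr (_ && _); last first.
  rewrite eqz_mod_dvd subr0 mulr_sumr mxE.
  by congr (_ %| _)%Z; apply: eq_bigr => i _; rewrite !mxE.
apply/forallP/forallP => h i; have := h i; rewrite eqz_mod_dvd subr0.
  case: (ltnP i r.-1) => //= i_ge _.
  suff -> : i = last_ord r_gt0 by rewrite subrr mulr0.
  apply/val_inj/eqP; rewrite eqn_leq i_ge andbT /=.
  by rewrite -ltnS prednK.
by move=> ->; rewrite implybT.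
Qed.

(* Both integer divisions are exact: d1 divides n, and gcdn n r divides n. *)
Theorem theorem6p1 (r n : nat) (r_gt0 : (0 < r)%N) (n_gt0 : (0 < n)%N)
    (c d : int) :
  let d1 : int := gcdz (c - d) n%:Z in
  let d2 : int := gcdz (c + (r%:Z - 1) * d) n%:Z in
  (S_cochar r n c d)%:R =
    (S_coroot n r_gt0 c d)%:R * (1 / n%:R)
    * (lcmz (gcdz d2 (d * n%:Z %/ d1)%Z) (n %/ gcdn n r)%N%:Z)%:~R :> rat.
Proof.
case: n n_gt0 => // n n_gt0 d1 d2.
set a := c - d; set e := c + (r%:Z - 1) * d.
have d1_neq0 : d1 != 0 by rewrite gcdz_eq0 andbF.
have /dvdzP [u aE] : (d1 %| a)%Z by exact: dvdz_gcdl.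
have /dvdzP [m nE] : (d1 %| n.+1%:Z)%Z by exact: dvdz_gcdr.
have gk : gcdz a (m * d1) = d1 by rewrite -nE.
have dnE : (d * n.+1%:Z %/ d1)%Z = d * m by rewrite nE mulrA mulzK.
set l := last_ord r_gt0.
(* The last entry makes the first form take the value a m + d m on x2, which is
   d m modulo n because n divides a m; a different coordinate would give d m
   directly, but need not exist when r = 1. *)
pose x2 : 'cV[int]_r := m *: delta_mx l ord0.
have Hx2 : equimod n.+1 r_gt0 a x2.
  by apply: equimod_scale; rewrite nE aE -mulrA [d1 * m]mulrC dvdz_mull.
have sumx2 : \sum_i x2 i ord0 = m.
  rewrite (bigD1 l) //= big1 => [|i /negPf il].
    by rewrite !mxE !eqxx mulr1 addr0.
  by rewrite !mxE il mulr0.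
have sum1 : \sum_(i < r) (const_mx 1 : 'cV[int]_r) i ord0 = r%:Z.
  by under eq_bigr do rewrite mxE; rewrite sumr_const card_ord natz.
have Hn (v : 'cV[int]_r) : equimod n.+1 r_gt0 a (n.+1%:Z *: v).
  by apply: equimod_scale; rewrite dvdz_mull.
pose w1 := row l (Bmx r c d); pose w2 : 'rV[int]_r := const_mx e.
have w1E (v : 'cV[int]_r) :
    (w1 *m v) ord0 ord0 = a * v l ord0 + d * \sum_j v j ord0.
  by rewrite -row_mul mxE Bmx_mul.
have w2E (v : 'cV[int]_r) : (w2 *m v) ord0 ord0 = e * \sum_j v j ord0.
  by rewrite mxE mulr_sumr; apply: eq_bigr => i _; rewrite !mxE.
have eE : e = a + r%:Z * d by rewrite /e /a; ring.
have sumH v : equimod n.+1 r_gt0 a v ->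
    exists s, \sum_i v i ord0 = r%:Z * v l ord0 + s * m.
  by rewrite nE; apply: equimod_sum.
(* Generators of the two images: the first arguments are the values at the all-ones vector, the
   second those at [x2], modulo [n.+1]. *)
pose g1 := gcdz (gcdz e (d * m)) n.+1.
pose g2 := gcdz (gcdz (e * r%:Z) (e * m)) n.+1.
pose h := #|[set x : 'cV['I_n.+1]_r | equimod n.+1 r_gt0 a (lift_int x)]|.
have K1 : (h * `|g1| = n.+1 * S_cochar r n.+1 c d)%N.
  rewrite (S_cocharE n r_gt0).
  apply: (@card_kernel_image n r (equimod n.+1 r_gt0 a) w1 (const_mx 1) x2
    e (d * m)) Hn _ Hx2 _ _ _; [exact: equimodD | exact: equimodZ |
    exact: equimod_const | | | ].
  - by rewrite w1E sum1 mxE eE; ring.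
  - rewrite w1E sumx2 addrK !mxE !eqxx mulr1 aE nE.
    by rewrite -mulrA [d1 * m]mulrC dvdz_mull.
  - move=> v /sumH [s sE]; rewrite w1E sE.
    rewrite (_ : _ + _ = v l ord0 * e + s * (d * m)); last by rewrite eE; ring.
    rewrite rpredD // dvdz_mull //; apply: dvdz_trans (dvdz_gcdl _ _) _.
      exact: dvdz_gcdl.
    exact: dvdz_gcdr.
have K2 : (h * `|g2| = n.+1 * S_coroot n.+1 r_gt0 c d)%N.
  rewrite S_corootE.
  apply: (@card_kernel_image n r (equimod n.+1 r_gt0 a) w2 (const_mx 1) x2
    (e * r%:Z) (e * m)) Hn _ Hx2 _ _ _; [exact: equimodD | exact: equimodZ |
    exact: equimod_const | | | ].
  - by rewrite w2E sum1.
  - by rewrite w2E sumx2 subrr.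
  - move=> v /sumH [s sE]; rewrite w2E sE.
    rewrite (_ : _ * _ = v l ord0 * (e * r%:Z) + s * (e * m)); last by ring.
    rewrite rpredD // dvdz_mull //; apply: dvdz_trans (dvdz_gcdl _ _) _.
      exact: dvdz_gcdl.
    exact: dvdz_gcdr.
have eaE : e - a = r%:Z * d by rewrite eE addrC addKr.
have gE := gcd_images nE aE eaE.
have -> : gcdz d2 (d * n.+1 %/ d1)%Z = g1 by rewrite dnE /d2 gcdzAC.
have g2E : (gcdn n.+1 r * gcdn `|g1| (n.+1 %/ gcdn n.+1 r) = `|g2|)%N.
  by rewrite /g2 -gE abszM; congr (_ * gcdn _ _)%N; rewrite /gcdz divz_nat.
(* After multiplication by [n.+1] both sides equal h g1 (n + 1). On the right, with G = gcd(n + 1,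
   r), this uses g2 = G gcd(g1, (n + 1) / G) and the fact that lcm times gcd is the product. *)
have SE : (S_cochar r n.+1 c d * n.+1 =
    S_coroot n.+1 r_gt0 c d * lcmn `|g1| (n.+1 %/ gcdn n.+1 r))%N.
  apply/eqP; rewrite -(eqn_pmul2l (ltn0Sn n)) !mulnA -K1 -K2 -g2E.
  rewrite -!mulnA [(gcdn `|g1| _ * _)%N]mulnC muln_lcm_gcd.
  rewrite [(gcdn n.+1 r * _)%N]mulnCA [(gcdn _ r * _)%N]mulnC.
  by rewrite divnK ?dvdn_gcdl.
rewrite /lcmz absz_nat -pmulrn mul1r mulrAC -natrM -SE natrM mulfK //.
by rewrite pnatr_eq0.
Qed.
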